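(* Let $n\ge 3$ and let $L=FR(n_{n,1})$ be a filiform Fock type Leibniz algebra over $\mathbb{F}$, i.e. a Leibniz algebra whose corresponding Lie algebra $L/I$ is isomorphic to $n_{n,1}$ and such that, under this isomorphism, the $n_{n,1}$-module $I$ is isomorphic to the Fock module $\mathbb{F}[x]$ of $n_{n,1}$. Then $L$ admits a basis $$\Big\{\overline{1},\ \overline{x},\ \overline{x^2},\ \dots,\ \overline{x^{n-2}},\ \frac{\overline{\delta}}{\delta x},\ x^{t}\ \Big|\ t\in\mathbb{N}\cup\{0\}\Big\}$$ in which the multiplication table is $$\begin{array}{ll} [\overline{x^i},\frac{\overline{\delta}}{\delta x}]=i\,\overline{x^{i-1}}, & 1\le i\le n-2,\\[1mm] [\frac{\overline{\delta}}{\delta x},\overline{x^i}]=-i\,\overline{x^{i-1}}, & 1\le i\le n-2,\\[1mm] [x^t,\overline{x^i}]=x^{t+i}, & 1\le i\le n-2,\ t\ge 0,\\[1mm] [x^t,\overline{1}]=x^t, & t\ge 0,\\[1mm] [x^t,\frac{\overline{\delta}}{\delta x}]=t\,x^{t-1}, & t\ge 0, \end{array}$$ where $\overline{x^0}=\overline{1}$, $\overline{x^1}=\overline{x}$, and all omitted products of basis elements are zero.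
   Context: $\mathbb{F}$ is an algebraically closed field of characteristic zero. A Leibniz algebra is an algebra $(L,[-,-])$ over $\mathbb{F}$ satisfying $[[x,y],z]=[[x,z],y]+[x,[y,z]]$ for all $x,y,z\in L$. Let $I$ be the ideal of $L$ generated by all squares $[x,x]$, $x\in L$. Then $[L,I]=0$, $L/I$ is a Lie algebra (the corresponding Lie algebra of $L$), and $I$ is an $L/I$-module via $I\times L/I\to I$, $(i,\overline{x})\mapsto[i,x]$. $n_{n,1}$ is the $n$-dimensional Lie algebra with basis $x_1,\dots,x_n$ and nonzero products $[x_i,x_1]=-[x_1,x_i]=x_{i+1}$ for $2\le i\le n-1$. In $n_{n,1}$ put $\frac{\overline{\delta}}{\delta x}=x_1$ and $\overline{x^{n-i}}=(n-i)!\,x_i$ for $2\le i\le n$ (so $\overline{1}=\overline{x^0}=x_n$). The Fock module of $n_{n,1}$ is the space $\mathbb{F}[x]$ of polynomials with the (right) action $$(p(x),\overline{1})\mapsto p(x),\quad (p(x),\overline{x^i})\mapsto x^ip(x),\quad \Big(p(x),\frac{\overline{\delta}}{\delta x}\Big)\mapsto \frac{d p(x)}{dx}.$$ *)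

(* Defs.v *)
From HB Require Import structures.
From mathcomp Require Import all_boot all_order all_algebra.
From mathcomp Require Import boolp zify ring.
Set Implicit Arguments.
Unset Strict Implicit.
Unset Printing Implicit Defensive.
Import GRing.Theory.
Local Open Scope ring_scope.
Local Open Scope quotient_scope.

(* Right Leibniz algebras of arbitrary dimension; [br x y] is [x, y]. *)
HB.mixin Record isLeibniz (F : fieldType) L & GRing.Lmodule F L := {
  br : L -> L -> L;
  linear_br : forall x, linear (br x);
  linear_brl : forall y, linear (br^~ y);
  br_leibniz : forall x y z, br (br x y) z = br (br x z) y + br x (br y z)
}.
#[short(type="leibnizType")]
HB.structure Definition Leibniz (F : fieldType) :=
  {L of isLeibniz F L & GRing.Lmodule F L}.

(* When [x, x] = 0 the bracket is antisymmetric, and the right Leibniz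
   identity is the Jacobi identity. *)
HB.mixin Record isLie (F : fieldType) L & Leibniz F L := {
  brxx : forall x : L, br x x = 0
}.
#[short(type="lieType")]
HB.structure Definition Lie (F : fieldType) := {L of isLie F L & Leibniz F L}.

(* Right modules over a Lie algebra. *)
HB.mixin Record isLieModule (F : fieldType) (g : lieType F) M
    & GRing.Lmodule F M := {
  act : M -> g -> M;
  linear_act : forall m, linear (act m);
  linear_actl : forall x, linear (act^~ x);
  act_br : forall m x y,
    act m (br x y) = act (act m x) y - act (act m y) x
}.
#[short(type="lieModType")]
HB.structure Definition LieModule (F : fieldType) (g : lieType F) :=
  {M of isLieModule F g M & GRing.Lmodule F M}.

Definition leibniz_iso (F : fieldType) (L L' : leibnizType F)
    (f : L -> L') : Prop :=
  [/\ linear f, bijective f & {morph f : x y / br x y}].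

(* [f] is an isomorphism from the g-module [M] to the g'-module [M'], the
   Lie algebras being identified through [phi]. *)
Definition module_iso_along (F : fieldType) (g g' : lieType F)
    (phi : g -> g') (M : lieModType g) (M' : lieModType g')
    (f : M -> M') : Prop :=
  [/\ linear f, bijective f & forall m x, f (act m x) = act (f m) (phi x)].

Section BracketTheory.
Context (F : fieldType) (L : leibnizType F).
Implicit Types x y z : L.

HB.instance Definition _ x :=
  GRing.isLinear.Build F L L *:%R (br x) (linear_br x).

Lemma br0l y : br 0 y = 0 :> L.
Proof.
by have := linear_brl y (-1) 0 0; rewrite scaler0 addr0 scaleN1r addNr.
Qed.

Lemma brDl x x' y : br (x + x') y = br x y + br x' y.
Proof. by have := linear_brl y 1 x x'; rewrite !scale1r. Qed.

Lemma brZl a x y : br (a *: x) y = a *: br x y.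
Proof. by have := linear_brl y a x 0; rewrite !addr0 br0l addr0. Qed.

Lemma brBl x x' y : br (x - x') y = br x y - br x' y.
Proof. by rewrite brDl -scaleN1r brZl scaleN1r. Qed.

Lemma brBr x y y' : br x (y - y') = br x y - br x y'.
Proof. exact: linearB. Qed.

Lemma br_sq x y : br x (br y y) = 0.
Proof. by apply: (addrI (br (br x y) y)); rewrite -br_leibniz addr0. Qed.

Definition is_ideal (S : L -> Prop) : Prop :=
  [/\ S 0, forall a x y, S x -> S y -> S (a *: x + y),
      forall x y, S x -> S (br x y) & forall x y, S y -> S (br x y)].

Definition sq_ideal : {pred L} := fun z =>
  `[< forall S, is_ideal S -> (forall x, S (br x x)) -> S z >].

Lemma sq_idealP z :
  reflect (forall S, is_ideal S -> (forall x, S (br x x)) -> S z)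
          (z \in sq_ideal).
Proof. exact: asboolP. Qed.

Lemma sq_ideal_ideal : is_ideal (fun z => z \in sq_ideal).
Proof.
split=> [|a x y /sq_idealP hx /sq_idealP hy|x y /sq_idealP hx|x y /sq_idealP hy];
  apply/sq_idealP=> S idS sqS; case: (idS)=> h0 hl hr hr'.
- exact: h0.
- by apply: hl; [apply: hx | apply: hy].
- by apply: hr; apply: hx.
- by apply: hr'; apply: hy.
Qed.

Lemma sq_ideal_sq x : br x x \in sq_ideal.
Proof. by apply/sq_idealP. Qed.

Lemma sq_ideal_brl x y : x \in sq_ideal -> br x y \in sq_ideal.
Proof. by case: sq_ideal_ideal => _ _ h _; apply: h. Qed.

Lemma br_sq_ideal x y : y \in sq_ideal -> br x y = 0.
Proof.
move=> /sq_idealP hy; move: x; apply: (hy (fun z => forall x, br x z = 0)).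
  split=> [x|a u v hu hv x|u v hu x|u v hv x].
  - by rewrite linear0.
  - by rewrite linear_br hu hv scaler0 addr0.
  - have := br_leibniz x u v.
    by rewrite hu br0l hu add0r.
  - by rewrite hv linear0.
by move=> x z; rewrite br_sq.
Qed.

Lemma sq_ideal_submod : subsemimod_closed sq_ideal.
Proof.
case: sq_ideal_ideal => h0 hl _ _.
split; first split=> // x y hx hy.
  by rewrite -[x]scale1r; apply: hl.
by move=> a x hx; rewrite -[_ *: _]addr0; apply: hl.
Qed.

HB.instance Definition _ :=
  GRing.isSubmodClosed.Build F L sq_ideal sq_ideal_submod.

End BracketTheory.

Section CorrespondingLie.
Context (F : fieldType) (L : leibnizType F).

(* L / I *)
Definition corr_lie := {ideal_quot (sq_ideal (L:=L))}.

HB.instance Definition _ := GRing.Zmodule.on corr_lie.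
HB.instance Definition _ := EqQuotient.on corr_lie.
Local Notation Q := corr_lie.

Lemma eq_corr_lie (x y : L) :
  (x - y) \in sq_ideal (L:=L) -> \pi_Q x = \pi_Q y.
Proof. by rewrite Quotient.idealrBE => /eqP. Qed.

Lemma repr_corr_lie (x : L) : repr (\pi_Q x) - x \in sq_ideal (L:=L).
Proof. by rewrite Quotient.idealrBE reprK. Qed.

Lemma pi_corr_lieD (x y : L) : \pi_Q (x + y) = \pi_Q x + \pi_Q y.
Proof. exact: Quotient.pi_add. Qed.

Definition corr_scale (a : F) (q : Q) : Q := \pi_Q (a *: repr q).
Definition corr_br (q r : Q) : Q := \pi_Q (br (repr q) (repr r)).

Lemma corr_scale_pi a (x : L) : corr_scale a (\pi_Q x) = \pi_Q (a *: x).
Proof. by apply: eq_corr_lie; rewrite -scalerBr rpredZ // repr_corr_lie. Qed.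

Lemma corr_br_pi (x y : L) : corr_br (\pi_Q x) (\pi_Q y) = \pi_Q (br x y).
Proof.
apply: eq_corr_lie.
have -> : br (repr (\pi_Q x)) (repr (\pi_Q y)) = br (repr (\pi_Q x)) y.
  by apply/eqP; rewrite -subr_eq0 -brBr br_sq_ideal // repr_corr_lie.
by rewrite -brBl sq_ideal_brl // repr_corr_lie.
Qed.

Lemma corr_lieP (q : Q) : {x : L | q = \pi_Q x}.
Proof. by exists (repr q); rewrite reprK. Qed.

Lemma corr_scaleA a b q : corr_scale a (corr_scale b q) = corr_scale (a * b) q.
Proof.
have [x ->] := corr_lieP q.
by rewrite (corr_scale_pi b) (corr_scale_pi a) (corr_scale_pi (a * b)) scalerA.
Qed.
Lemma corr_scale1 : left_id 1 corr_scale.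
Proof. by move=> q; have [x ->] := corr_lieP q; rewrite corr_scale_pi scale1r. Qed.
Lemma corr_scaleDr : right_distributive corr_scale +%R.
Proof.
move=> a q r; have [x ->] := corr_lieP q; have [y ->] := corr_lieP r.
rewrite -pi_corr_lieD (corr_scale_pi a x) (corr_scale_pi a y).
by rewrite (corr_scale_pi a (x + y)) scalerDr pi_corr_lieD.
Qed.
Lemma corr_scaleDl q : {morph corr_scale^~ q : a b / a + b}.
Proof.
move=> a b; have [x ->] := corr_lieP q.
by rewrite (corr_scale_pi a) (corr_scale_pi b) (corr_scale_pi (a + b)) scalerDl
  pi_corr_lieD.
Qed.

HB.instance Definition _ := GRing.Zmodule_isLmodule.Build F corr_lie
  corr_scaleA corr_scale1 corr_scaleDr corr_scaleDl.

Lemma pi_corr_lieZ a (x : L) : \pi_Q (a *: x) = a *: \pi_Q x.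
Proof. exact/esym/corr_scale_pi. Qed.

Lemma corr_linear_br q : linear (corr_br q).
Proof.
move=> a r s; have [x ->] := corr_lieP q.
have [y ->] := corr_lieP r; have [z ->] := corr_lieP s.
rewrite -pi_corr_lieZ -pi_corr_lieD (corr_br_pi x y) (corr_br_pi x z).
by rewrite (corr_br_pi x (a *: y + z)) linear_br pi_corr_lieD pi_corr_lieZ.
Qed.
Lemma corr_linear_brl r : linear (corr_br^~ r).
Proof.
move=> a q s; have [x ->] := corr_lieP r.
have [y ->] := corr_lieP q; have [z ->] := corr_lieP s.
rewrite -pi_corr_lieZ -pi_corr_lieD (corr_br_pi y x) (corr_br_pi z x).
by rewrite (corr_br_pi (a *: y + z) x) linear_brl pi_corr_lieD pi_corr_lieZ.
Qed.
Lemma corr_leibniz p q r :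
  corr_br (corr_br p q) r = corr_br (corr_br p r) q + corr_br p (corr_br q r).
Proof.
have [x ->] := corr_lieP p; have [y ->] := corr_lieP q.
have [z ->] := corr_lieP r.
rewrite (corr_br_pi x y) (corr_br_pi x z) (corr_br_pi y z).
rewrite (corr_br_pi (br x y) z) (corr_br_pi (br x z) y) (corr_br_pi x (br y z)).
by rewrite br_leibniz pi_corr_lieD.
Qed.
HB.instance Definition _ := isLeibniz.Build F corr_lie
  corr_linear_br corr_linear_brl corr_leibniz.

Lemma pi_corr_lie_br (x y : L) : \pi_Q (br x y) = br (\pi_Q x) (\pi_Q y).
Proof. exact/esym/corr_br_pi. Qed.

Lemma corr_brxx (q : Q) : br q q = 0.
Proof.
have [x ->] := corr_lieP q; rewrite -pi_corr_lie_br.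
apply: (addrI (\pi_Q 0)); rewrite addr0 -pi_corr_lieD.
by apply: eq_corr_lie; rewrite add0r subr0 sq_ideal_sq.
Qed.
HB.instance Definition _ := isLie.Build F corr_lie corr_brxx.

(* I as a right L / I-module, with action (i, class of x) |-> [i, x]. *)
Definition sq_ideal_type := {x : L | x \in sq_ideal (L:=L)}.

HB.instance Definition _ := SubChoice.on sq_ideal_type.
HB.instance Definition _ := [SubChoice_isSubLmodule of sq_ideal_type by <:].

Definition sq_act (i : sq_ideal_type) (q : corr_lie) : sq_ideal_type :=
  exist _ (br (val i) (repr q)) (sq_ideal_brl (repr q) (valP i)).

Lemma val_sq_act i (x : L) : val (sq_act i (\pi_Q x)) = br (val i) x.
Proof.
by apply/eqP; rewrite -subr_eq0 -brBr br_sq_ideal // repr_corr_lie.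
Qed.

Lemma val_sqP a (i j : sq_ideal_type) : val (a *: i + j) = a *: val i + val j.
Proof. by []. Qed.
Lemma val_sqB (i j : sq_ideal_type) : val (i - j) = val i - val j.
Proof. by []. Qed.

Lemma sq_linear_act i : linear (sq_act i).
Proof.
move=> a q r; have [x ->] := corr_lieP q; have [y ->] := corr_lieP r.
apply: val_inj; rewrite -pi_corr_lieZ -pi_corr_lieD val_sqP.
by rewrite (val_sq_act i x) (val_sq_act i y) (val_sq_act i (a *: x + y)) linear_br.
Qed.
Lemma sq_linear_actl q : linear (sq_act^~ q).
Proof.
move=> a i j; have [x ->] := corr_lieP q; apply: val_inj; rewrite val_sqP.
rewrite (val_sq_act i x) (val_sq_act j x) (val_sq_act (a *: i + j) x).
by rewrite val_sqP linear_brl.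
Qed.
Lemma sq_act_br i q r :
  sq_act i (br q r) = sq_act (sq_act i q) r - sq_act (sq_act i r) q.
Proof.
have [x ->] := corr_lieP q; have [y ->] := corr_lieP r.
apply: val_inj; rewrite -pi_corr_lie_br val_sqB.
rewrite (val_sq_act _ (br x y)) (val_sq_act (sq_act i _) y).
rewrite (val_sq_act (sq_act i _) x) (val_sq_act i x) (val_sq_act i y).
by rewrite [br (br _ x) _]br_leibniz addrAC subrr add0r.
Qed.
HB.instance Definition _ := isLieModule.Build F corr_lie sq_ideal_type
  sq_linear_act sq_linear_actl sq_act_br.

End CorrespondingLie.

Section NN1.
Context (F : fieldType) (n : nat).

Definition nn1 := 'rV[F]_n.
HB.instance Definition _ := GRing.Lmodule.on nn1.

(* x_1, ..., x_n, numbered from 1; [nn1_x k = 0] for other k. *)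
Definition nn1_x (k : nat) : 'rV[F]_n := \row_(j < n) (j.+1 == k)%:R.

(* [nn1_table i j] is [x_i, x_j]. *)
Definition nn1_table (i j : nat) : 'rV[F]_n :=
  if (2 <= i <= n.-1)%N && (j == 1%N) then nn1_x i.+1
  else if (i == 1%N) && (2 <= j <= n.-1)%N then - nn1_x j.+1
  else 0.

Definition nn1_br (u v : 'rV[F]_n) : 'rV[F]_n :=
  \sum_(i < n) \sum_(j < n) (u 0 i * v 0 j) *: nn1_table i.+1 j.+1.

Definition nn1_coord (u : 'rV[F]_n) (k : nat) : F := \sum_(i < n | i == k :> nat) u 0 i.

Lemma nn1_coordE (u : 'rV[F]_n) (k : 'I_n) : u 0 k = nn1_coord u k.
Proof. by rewrite /nn1_coord (big_pred1 k). Qed.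

Lemma nn1_coordP k : linear (nn1_coord^~ k : 'rV[F]_n -> F^o).
Proof.
move=> a u v; rewrite /nn1_coord scaler_sumr -big_split.
by apply: eq_bigr => i _; rewrite !mxE.
Qed.

Lemma nn1_tableE i j (k : 'I_n) : (i < n)%N -> (j < n)%N ->
  nn1_table i.+1 j.+1 0 k =
  (1 < k)%:R * ((i == k.-1)%:R * (j == 0)%:R - (i == 0)%:R * (j == k.-1)%:R).
Proof.
move=> hi hj; have hk := ltn_ord k; rewrite /nn1_table.
case: ifP => [c1|c1]; [|case: ifP => [c2|c2]]; rewrite !mxE;
  move: (nat_of_ord k) hk => m hm; case: (ltnP 1 m) => h1; rewrite ?mul0r;
  repeat case: eqP => ? /=;
  rewrite ?(mulr0, mul0r, mulr1, mul1r, subr0, sub0r, oppr0, subrr) //;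
  by exfalso; lia.
Qed.

Lemma nn1_brE (u v : 'rV[F]_n) (k : 'I_n) : nn1_br u v 0 k = (1 < k)%:R *
  (nn1_coord u k.-1 * nn1_coord v 0 - nn1_coord u 0 * nn1_coord v k.-1).
Proof.
have cE w m : nn1_coord w m = \sum_(i < n) w 0 i * (i == m :> nat)%:R.
  rewrite /nn1_coord big_mkcond; apply: eq_bigr => i _.
  by case: eqP; rewrite ?mulr1 ?mulr0.
rewrite !cE !big_distrlr /= -sumrB mulr_sumr /nn1_br summxE.
apply: eq_bigr => i _; rewrite summxE -sumrB mulr_sumr.
apply: eq_bigr => j _; rewrite mxE nn1_tableE //.
by ring.
Qed.

Lemma nn1_coord_br u v k : nn1_coord (nn1_br u v) k = (1 < k < n)%:R *
  (nn1_coord u k.-1 * nn1_coord v 0 - nn1_coord u 0 * nn1_coord v k.-1).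
Proof.
case: (ltnP k n) => hk; last first.
  rewrite andbF mul0r /nn1_coord big_pred0 // => i.
  by apply/negbTE/eqP => ik; have := ltn_ord i; rewrite ik ltnNge hk.
by rewrite andbT -[k]/(val (Ordinal hk)) -nn1_coordE nn1_brE.
Qed.

Lemma nn1_coordD k a (u v : 'rV[F]_n) :
  nn1_coord (a *: u + v) k = a * nn1_coord u k + nn1_coord v k.
Proof. exact: nn1_coordP. Qed.

Lemma nn1_linear_br (u : nn1) : linear (nn1_br u : nn1 -> nn1).
Proof.
move=> a v w; apply/rowP => k; rewrite !mxE !nn1_brE !nn1_coordD; ring.
Qed.
Lemma nn1_linear_brl (v : nn1) : linear (nn1_br^~ v : nn1 -> nn1).
Proof.
move=> a u w; apply/rowP => k; rewrite !mxE !nn1_brE !nn1_coordD; ring.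
Qed.
Lemma nn1_leibniz (u v w : nn1) : nn1_br (nn1_br u v) w =
  nn1_br (nn1_br u w) v + nn1_br u (nn1_br v w).
Proof.
apply/rowP => k; rewrite !mxE !nn1_brE !nn1_coord_br /=; ring.
Qed.
HB.instance Definition _ := isLeibniz.Build F nn1
  nn1_linear_br nn1_linear_brl nn1_leibniz.

Lemma nn1_brxx (u : nn1) : nn1_br u u = 0.
Proof. by apply/rowP => k; rewrite nn1_brE !mxE; ring. Qed.
HB.instance Definition _ := isLie.Build F nn1 nn1_brxx.

Lemma nn1_br_x i j : (1 <= i <= n)%N -> (1 <= j <= n)%N ->
  br (nn1_x i : nn1) (nn1_x j) = nn1_table i j.
Proof.
case: i => // i /= hi; case: j => // j /= hj.
rewrite /br /= /nn1_br (bigD1 (Ordinal hi)) //= (bigD1 (Ordinal hj)) //=.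
rewrite !mxE !eqxx mulr1 scale1r !big1 ?addr0 // => k.
  move=> hk; rewrite big1 // => l _; rewrite !mxE eqSS.
  by rewrite -[k == i :> nat]/(k == Ordinal hi) (negbTE hk) mul0r scale0r.
move=> hk; rewrite !mxE [in X in _ * X]eqSS.
by rewrite -[k == j :> nat]/(k == Ordinal hj) (negbTE hk) mulr0 scale0r.
Qed.

End NN1.

Section Fock.
(* Characteristic zero is needed for the module axiom. *)
Context (F : fieldType) (charF : [pchar F] =i pred0) (n : nat).

Definition fock (_ : [pchar F] =i pred0) (_ : nat) := {poly F}.
Local Notation M := (fock charF n).
HB.instance Definition _ := GRing.Lmodule.on M.

(* \bar{x^k} = k! x_{n-k} (0 <= k <= n - 2), and \bar{delta}/delta x = x_1. *)
Definition nn1_xbar (k : nat) : nn1 F n := k`!%:R *: nn1_x F n (n - k).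
Definition nn1_dbar : nn1 F n := nn1_x F n 1.

(* Action of x_i: p |-> p' for i = 1, and p |-> x^(n-i) p / (n-i)! for
   2 <= i <= n. *)
Definition fock_gen (p : {poly F}) (i : nat) : {poly F} :=
  if i == 1%N then p^`() else ((n - i)`!%:R)^-1 *: ('X^(n - i) * p).

Definition fock_act (p : {poly F}) (u : 'rV[F]_n) : {poly F} :=
  \sum_(i < n) u 0 i *: fock_gen p i.+1.

Lemma fock_linear_act (p : M) : linear (fock_act p : nn1 F n -> M).
Proof.
move=> a u v; rewrite /fock_act scaler_sumr -big_split; apply: eq_bigr => i _.
by rewrite !mxE scalerDl scalerA.
Qed.
Lemma fock_linear_actl (u : nn1 F n) : linear (fock_act^~ u : M -> M).
Proof.
move=> a p q; rewrite /fock_act scaler_sumr -big_split; apply: eq_bigr => i _.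
rewrite /fock_gen; case: ifP => _.
  by rewrite linearP scalerDr !scalerA mulrC.
rewrite mulrDr -scalerAr !scalerDr !scalerA; congr (_ *: _ + _); ring.
Qed.

Definition fock_mulp (u : 'rV[F]_n) : {poly F} :=
  \poly_(k < n.-1) ((k`!%:R)^-1 * nn1_coord u (n - k).-1).

Lemma fock_actE p u : fock_act p u = nn1_coord u 0 *: p^`() + fock_mulp u * p.
Proof.
rewrite /fock_mulp /fock_act /fock_gen poly_def; case: n u => [|m] u.
  by rewrite /nn1_coord !big_ord0 scale0r mul0r addr0.
rewrite big_ord_recl -[ord0]/(@ord0 m) (nn1_coordE u ord0) /=; congr (_ + _).
rewrite /= (reindex_inj rev_ord_inj) mulr_suml; apply: eq_bigr => i _.
rewrite (nn1_coordE u) /= -scalerAl scalerA mulrC.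
have hi : (i < m)%N := ltn_ord i.
have -> : (m.+1 - (bump 0 (m - i.+1)).+1 = i)%N by rewrite /bump; lia.
by have -> : bump 0 (m - i.+1) = (m.+1 - i).-1 by rewrite /bump; lia.
Qed.

Lemma fock_mulp_br u v : fock_mulp (nn1_br u v) =
  nn1_coord v 0 *: (fock_mulp u)^`() - nn1_coord u 0 *: (fock_mulp v)^`().
Proof.
apply/polyP => k; rewrite coefB !coefZ !coef_deriv !coef_poly.
case: (ltnP k.+1 n.-1) => [hk|hk]; last first.
  rewrite mul0rn !mulr0 subr0; case: ifP => // hk'; rewrite nn1_coord_br.
  by rewrite (_ : (_ < _ < _)%N = false) ?mul0r ?mulr0 //; lia.
rewrite ltnW // nn1_coord_br (_ : (_ < _ < _)%N = true) ?mul1r; last by lia.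
have kS : (k.+1`!%:R)^-1 * k.+1%:R = (k`!%:R)^-1 :> F.
  rewrite factS natrM invfM mulrAC mulVf ?mul1r //.
  by move/pcharf0P: charF => ->.
rewrite -kS (_ : (n - k).-1.-1 = (n - k.+1).-1)%N; last by lia.
rewrite -(mulr_natr (_ * nn1_coord u _)) -(mulr_natr (_ * nn1_coord v _)).
by move: ((k.+1)`!%:R^-1) (k.+1%:R) => A B; ring.
Qed.

Lemma fock_act_br (p : M) (u v : nn1 F n) : fock_act p (br u v) =
  fock_act (fock_act p u) v - fock_act (fock_act p v) u :> M.
Proof.
have br0 : nn1_coord (nn1_br u v) 0 = 0 by rewrite nn1_coord_br mul0r.
rewrite !fock_actE br0 scale0r add0r fock_mulp_br !derivE.
rewrite -!mul_polyC; ring.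
Qed.
HB.instance Definition _ := isLieModule.Build F (nn1 F n) M
  fock_linear_act fock_linear_actl fock_act_br.

Lemma fock_act_x (p : M) i : (1 <= i <= n)%N ->
  act p (nn1_x F n i) = fock_gen p i :> {poly F}.
Proof.
case: i => // i hi; rewrite /act /= /fock_act (bigD1 (Ordinal hi)) //=.
rewrite mxE eqxx scale1r big1 ?addr0 // => k hk; rewrite mxE eqSS.
by rewrite -[k == i :> nat]/(k == Ordinal hi) (negbTE hk) scale0r.
Qed.

Lemma fock_act_dbar (p : M) : (1 <= n)%N -> act p nn1_dbar = p^`() :> {poly F}.
Proof. by move=> n_gt0; rewrite /nn1_dbar fock_act_x //. Qed.

Lemma fock_act_xbar (p : M) k : (k + 2 <= n)%N ->
  act p (nn1_xbar k) = 'X^k * p :> {poly F}.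
Proof.
move=> hk; have := linear_act p k`!%:R (nn1_x F n (n - k)) 0.
have act0 : act p (0 : nn1 F n) = 0.
  by have := linear_act p (-1) (0 : nn1 F n) 0; rewrite scaler0 addr0 scaleN1r addNr.
rewrite addr0 act0 addr0 => ->; rewrite fock_act_x; last by lia.
rewrite /fock_gen (_ : (n - k == 1)%N = false); last by lia.
rewrite subKn ?scalerA ?divff ?scale1r //; last by lia.
by have /pcharf0P -> := charF; rewrite -lt0n fact_gt0.
Qed.

Lemma nn1_br_xbar_dbar k : (k + 2 <= n)%N ->
  br (nn1_xbar k) nn1_dbar = k%:R *: nn1_xbar k.-1.
Proof.
move=> hk; rewrite brZl nn1_br_x; [|lia..].
rewrite /nn1_table eqxx andbT scalerA; case: k hk => [|k] hk.
  rewrite mul0r scale0r (_ : (_ <= _ <= _)%N = false) ?subn0; last by lia.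
  by rewrite (_ : (_ && _) = false) ?scaler0 //; lia.
rewrite (_ : (_ <= _ <= _)%N = true) /=; last by lia.
by rewrite factS natrM (_ : (n - k.+1).+1 = (n - k)%N) //; lia.
Qed.
End Fock.

(* Filiform Fock type Leibniz algebras: [phi] identifies L / I with n_{n,1},
   and [psi] identifies I with the Fock module along [phi]. *)
Definition filiform_Fock (F : fieldType) (charF : [pchar F] =i pred0) (n : nat)
    (L : leibnizType F) : Prop :=
  exists (phi : corr_lie L -> nn1 F n) (psi : sq_ideal_type L -> fock charF n),
    leibniz_iso phi /\ module_iso_along phi psi.

Definition is_basis (F : fieldType) (V : lmodType F) (J : eqType)
    (e : J -> V) : Prop :=
  (forall (s : seq J) (c : J -> F), uniq s ->
     \sum_(j <- s) c j *: e j = 0 -> forall j, j \in s -> c j = 0) /\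
  (forall v, exists (s : seq J) (c : J -> F), v = \sum_(j <- s) c j *: e j).

(* Labels of the basis: [xbar i] for \bar{x^i} with 0 <= i <= n - 2,
   [dbar] for \bar{delta}/delta x, and [xpow t] for x^t. *)
Variant fock_label (n : nat) :=
  | xbar of 'I_n.-1
  | dbar
  | xpow of nat.
Arguments dbar {n}.
Arguments xpow {n} t.

Section FockLabel.
Context (n : nat).
Definition fock_label_code (l : fock_label n) : 'I_n.-1 + option nat :=
  match l with
  | xbar i => inl i
  | dbar => inr None
  | xpow t => inr (Some t)
  end.
Definition fock_label_decode (c : 'I_n.-1 + option nat) : fock_label n :=
  match c with
  | inl i => xbar i
  | inr None => dbar
  | inr (Some t) => xpow t
  end.
Lemma fock_label_codeK : cancel fock_label_code fock_label_decode.
Proof. by case. Qed.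
HB.instance Definition _ := Countable.copy (fock_label n)
  (can_type fock_label_codeK).
End FockLabel.

Definition fock_basis (F : fieldType) (L : lmodType F) (n : nat)
    (xb : nat -> L) (d : L) (xt : nat -> L) (l : fock_label n) : L :=
  match l with
  | xbar i => xb i
  | dbar => d
  | xpow t => xt t
  end.

(* [1 <= i] singles out the index range of the first three rows of the
   multiplication table; [x^0, \bar{delta}/delta x] = 0%:R *: x^0 = 0. *)
Definition fock_table (F : fieldType) (L : lmodType F) (n : nat)
    (xb : nat -> L) (d : L) (xt : nat -> L) (a b : fock_label n) : L :=
  match a, b with
  | xbar i, dbar => if (1 <= i)%N then i%:R *: xb i.-1 else 0
  | dbar, xbar i => if (1 <= i)%N then - (i%:R *: xb i.-1) else 0
  | xpow t, xbar i => if (1 <= i)%N then xt (t + i)%N else xt t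
  | xpow t, dbar => t%:R *: xt t.-1
  | _, _ => 0
  end.

(* Main.v *)
From HB Require Import structures.
Require Import Defs.
From mathcomp Require Import all_boot all_order all_algebra.
From mathcomp Require Import zify.
Import GRing.Theory.
Local Open Scope ring_scope.

(** The proof is that the extension of $n_{n,1}$ by the Fock module splits, and
    that it does so because the central element $z = \overline{1}$ acts on the
    ideal $I$ of squares as the identity.  Right multiplication by a lift of
    $z$ sends $L$ into $I$ ($z$ is central modulo $I$) and is the identity on
    $I$, so it is a projection of $L$ onto $I$.  As $[L, I] = 0$, the Leibniz
    identity reduces to $[[x, y], z] = [[x, z], y]$, which makes the
    complementary projection $x \mapsto x - [x, z]$ an endomorphism of the
    algebra $L$ with kernel $I$ ([unit_compl_br], [unit_compl_ideal]).  Its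
    image, the kernel of right multiplication by $z$, is therefore a
    subalgebra isomorphic to $L / I$ ([unit_section_br]).

    Hence $L$ is the semidirect product of a copy of $n_{n,1}$ and of
    $\mathbb{F}[x]$, with $[L, \mathbb{F}[x]] = 0$.  Lifting
    $\overline{x^i}$ and $\overline{\delta}/\delta x$ to the copy of
    $n_{n,1}$, and taking the monomials in $I$, gives the table: its entries
    are brackets in $n_{n,1}$, or values of the Fock action, or zero.  These
    elements form a basis because they are biorthogonal to the linear forms
    giving the coordinates of the class of $v$ in $n_{n,1}$ and the
    coefficients of the polynomial $[v, z]$. *)

(** * Splitting off an ideal on which a central element acts as the identity *)

Section UnitSplitting.
Context {F : fieldType} {L : leibnizType F} (z : L).
Context (br_z_ideal : forall x, br x z \in sq_ideal (L := L)).
Context (ideal_br_z : forall x, x \in sq_ideal (L := L) -> br x z = x).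
Implicit Types x y : L.
Local Notation Q := (corr_lie L).

Definition unit_compl x : L := x - br x z.

Lemma unit_compl_linear : linear unit_compl.
Proof.
by move=> a x y; rewrite /unit_compl linear_brl scalerBr opprD addrACA.
Qed.

Lemma unit_compl_ideal x : x \in sq_ideal (L := L) -> unit_compl x = 0.
Proof. by move=> xI; rewrite /unit_compl ideal_br_z // subrr. Qed.

Lemma br_unit_compl_z x : br (unit_compl x) z = 0.
Proof. by rewrite brBl (ideal_br_z _ (br_z_ideal x)) subrr. Qed.

(** In the Leibniz identity for $[[x, y], z]$ the term $[x, [y, z]]$ lies in
    $[L, I] = 0$, so right multiplication by $z$ commutes with that by $y$. *)
Lemma unit_compl_br x y :
  unit_compl (br x y) = br (unit_compl x) (unit_compl y).
Proof.
rewrite brBr (br_sq_ideal _ (br_z_ideal y)) subr0 brBl /unit_compl.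
by rewrite br_leibniz (br_sq_ideal _ (br_z_ideal y)) addr0.
Qed.

Definition unit_section (q : Q) : L := unit_compl (repr q).

Lemma unit_section_pi x : unit_section (\pi_Q x)%qT = unit_compl x.
Proof.
apply/eqP; rewrite -subr_eq0 -scaleN1r addrC -unit_compl_linear scaleN1r addrC.
by rewrite unit_compl_ideal // repr_corr_lie.
Qed.

Lemma unit_sectionK q : (\pi_Q (unit_section q))%qT = q.
Proof.
rewrite -[RHS]reprK; apply: eq_corr_lie.
by rewrite addrAC subrr add0r rpredN br_z_ideal.
Qed.

Lemma unit_section_linear : linear unit_section.
Proof.
move=> a q r; have [x ->] := corr_lieP q; have [y ->] := corr_lieP r.
by rewrite -pi_corr_lieZ -pi_corr_lieD !unit_section_pi unit_compl_linear.
Qed.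

Lemma unit_section_br : {morph unit_section : q r / br q r}.
Proof.
move=> q r; have [x ->] := corr_lieP q; have [y ->] := corr_lieP r.
by rewrite -pi_corr_lie_br !unit_section_pi unit_compl_br.
Qed.

End UnitSplitting.

(** * Bases from biorthogonal systems *)

(** A combination of the [e j] is recovered from its values under the forms
    [f j], so the forms prove independence; for the same reason [f j v] are
    the only coefficients that can be asked for in the spanning hypothesis. *)
Lemma biorthogonal_basis (F : fieldType) (V : lmodType F) (J : eqType)
    (e : J -> V) (f : J -> V -> F) :
    (forall j a u v, f j (a *: u + v) = a * f j u + f j v) ->
    (forall i j, f i (e j) = (i == j)%:R) ->
    (forall v, exists s : seq J, v = \sum_(j <- s) f j v *: e j) ->
  is_basis e.
Proof.
move=> f_lin f_e f_span; split=> [s c s_uniq sum0 j js|v]; last first.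
  by have [s] := f_span v; exists s, (f^~ v).
have f0 : f j 0 = 0.
  by have := f_lin j (-1) 0 0; rewrite scaler0 addr0 mulN1r addNr.
have f_sum r : f j (\sum_(i <- r) c i *: e i) = \sum_(i <- r) c i * (j == i)%:R.
  by elim: r => [|i r IHr]; rewrite ?big_nil // !big_cons f_lin IHr f_e.
have := f_sum s; rewrite sum0 f0 (bigD1_seq j) //= eqxx mulr1.
rewrite big1 ?addr0 // => i ij.
by rewrite eq_sym (negbTE ij) mulr0.
Qed.

(** * The filiform algebra $n_{n,1}$ *)

Lemma lie_br_antisym (F : fieldType) (g : lieType F) (u v : g) :
  br v u = - br u v.
Proof.
apply/eqP; rewrite -addr_eq0; apply/eqP.
have := brxx (u + v); rewrite brDl !linearD /= !brxx add0r addr0.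
by rewrite addrC.
Qed.

Section FiliformAlgebra.
Context (F : fieldType) (n : nat).
Local Notation xb := (nn1_xbar F n).

Lemma nn1_br_xbar i j : (i + 2 <= n)%N -> (j + 2 <= n)%N ->
  br (xb i) (xb j) = 0.
Proof.
move=> hi hj; rewrite brZl linearZ /= nn1_br_x; [|lia..].
rewrite /nn1_table (_ : (n - j == 1)%N = false); last by lia.
by rewrite andbF (_ : (n - i == 1)%N = false) ?scaler0 //; lia.
Qed.

Lemma nn1_xbarE k (i : 'I_n) : xb k 0 i = k`!%:R * (i.+1 == n - k)%N%:R.
Proof. by rewrite !mxE. Qed.

Lemma nn1_coord_x i k :
  (k < n)%N -> nn1_coord (nn1_x F n i) k = (k.+1 == i)%:R.
Proof. by move=> hk; rewrite -[k]/(val (Ordinal hk)) -nn1_coordE mxE. Qed.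

Lemma nn1_coord_xbar i k :
  (k < n)%N -> nn1_coord (xb i) k = i`!%:R * (k.+1 == n - i)%N%:R.
Proof. by move=> hk; rewrite -[k]/(val (Ordinal hk)) -nn1_coordE nn1_xbarE. Qed.

(** $\overline{1} = x_n$ is central, as the brackets of $n_{n,1}$ do not
    involve the coordinate along $x_n$ of their arguments. *)
Lemma nn1_br_xbar0 (u : nn1 F n) : (2 <= n)%N -> br u (xb 0) = 0.
Proof.
move=> n_ge2; apply/rowP => k; rewrite [LHS]nn1_brE mxE.
have coord_xbar0 m : (m.+1 < n)%N -> nn1_coord (xb 0) m = 0.
  move=> hm; rewrite nn1_coord_xbar; last by lia.
  by rewrite (_ : (_ == _)%N = false) ?mulr0 //; lia.
have hk := ltn_ord k.
by rewrite !coord_xbar0 ?mulr0 ?subr0 ?mulr0 //; lia.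
Qed.

End FiliformAlgebra.

(** * The semidirect product decomposition *)

Lemma linear_cancel (F : fieldType) (U V : lmodType F) (f : U -> V)
    (g : V -> U) :
  linear f -> cancel f g -> cancel g f -> linear g.
Proof. by move=> f_lin fK gK a u v; apply: (can_inj fK); rewrite f_lin !gK. Qed.

Section FockSplitting.
Set Implicit Arguments.
Unset Strict Implicit.
Context {F : fieldType} (charF : [pchar F] =i pred0) (n : nat).
Local Notation g := (nn1 F n).
Local Notation M := (fock charF n).

(** [L] is the direct sum of the images of [split_sec] and [split_inj], with
    [split_cls] and [split_poly] the two components of an element; the bracket
    is that of the semidirect product of [g] by the module [M] on which
    [L] acts trivially from the left. *)
Record fock_splitting (L : leibnizType F) := FockSplitting {
  split_cls : L -> g;
  split_sec : g -> L;
  split_poly : L -> M;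
  split_inj : M -> L;
  split_cls_linear : linear split_cls;
  split_sec_linear : linear split_sec;
  split_poly_linear : linear split_poly;
  split_inj_linear : linear split_inj;
  split_secK : cancel split_sec split_cls;
  split_injK : cancel split_inj split_poly;
  split_cls_inj : forall p, split_cls (split_inj p) = 0;
  split_poly_sec : forall u, split_poly (split_sec u) = 0;
  split_decomp : forall v, v = split_sec (split_cls v) + split_inj (split_poly v);
  split_sec_br : {morph split_sec : u v / br u v};
  split_br_inj_sec : forall p u,
    br (split_inj p) (split_sec u) = split_inj (act p u);
  split_br_inj : forall v p, br v (split_inj p) = 0
}.

HB.instance Definition _ (L : leibnizType F) (S : fock_splitting L) :=
  GRing.isLinear.Build F L g *:%R (split_cls S) (split_cls_linear S).
HB.instance Definition _ (L : leibnizType F) (S : fock_splitting L) :=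
  GRing.isLinear.Build F g L *:%R (split_sec S) (split_sec_linear S).
HB.instance Definition _ (L : leibnizType F) (S : fock_splitting L) :=
  GRing.isLinear.Build F L M *:%R (split_poly S) (split_poly_linear S).
HB.instance Definition _ (L : leibnizType F) (S : fock_splitting L) :=
  GRing.isLinear.Build F M L *:%R (split_inj S) (split_inj_linear S).

(** Here [z] is a lift of $\overline{1} = x_n$: as $x_n$ is central, $[L, z]$
    lies in the ideal of squares, and as it acts on the Fock module as
    $x^0 = 1$, right multiplication by [z] fixes that ideal. *)
Lemma filiform_Fock_split (L : leibnizType F) :
  (2 <= n)%N -> filiform_Fock charF n L -> inhabited (fock_splitting L).
Proof.
move=> n_ge2 [phi [psi [[phi_lin [phi' phiK phiK'] phi_br]]]].
move=> [psi_lin [psi' psiK psiK'] psi_act].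
have phi'_lin := linear_cancel _ _ _ _ _ phi_lin phiK phiK'.
have psi'_lin := linear_cancel _ _ _ _ _ psi_lin psiK psiK'.
have psi0 : psi 0 = 0.
  by have := psi_lin (-1) 0 0; rewrite scaler0 addr0 scaleN1r addNr.
have phi'_br u v : phi' (br u v) = br (phi' u) (phi' v).
  by apply: (can_inj phiK); rewrite phi_br !phiK'.
pose cls (x : L) : g := phi (\pi_(corr_lie L) x)%qT.
have cls_lin : linear cls.
  by move=> a x y; rewrite /cls pi_corr_lieD pi_corr_lieZ phi_lin.
have pi0 : (\pi_(corr_lie L) 0)%qT = 0.
  by rewrite -(scale0r (0 : L)) pi_corr_lieZ scale0r.
have mem_pi (x : L) : (\pi_(corr_lie L) x)%qT = 0 -> x \in sq_ideal (L := L).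
  by move=> x0; rewrite -[x]subr0 Quotient.idealrBE pi0 x0.
have pi_mem (x : L) : x \in sq_ideal (L := L) -> (\pi_(corr_lie L) x)%qT = 0.
  by move=> xI; rewrite -pi0; apply: eq_corr_lie; rewrite subr0.
have phi0 : phi 0 = 0.
  by have := phi_lin (-1) 0 0; rewrite scaler0 addr0 scaleN1r addNr.
pose z : L := repr (phi' (nn1_xbar F n 0)).
have phi_z : cls z = nn1_xbar F n 0 by rewrite /cls reprK phiK'.
have br_z_ideal (x : L) : br x z \in sq_ideal (L := L).
  apply: mem_pi; apply: (can_inj phiK).
  rewrite phi0 pi_corr_lie_br phi_br -/(cls x) -/(cls z) phi_z.
  exact: nn1_br_xbar0.
have ideal_br_z (x : L) : x \in sq_ideal (L := L) -> br x z = x.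
  move=> xI; pose i : sq_ideal_type L := exist _ x xI.
  rewrite -[x]/(val i) -val_sq_act; congr val; apply: (can_inj psiK).
  rewrite psi_act -/(cls z) phi_z fock_act_xbar //.
  by rewrite expr0 mul1r.
pose sec (u : g) : L := unit_section z (phi' u).
pose i_z (x : L) : sq_ideal_type L := exist _ (br x z) (br_z_ideal x).
pose poly (x : L) : M := psi (i_z x).
pose inj (p : M) : L := val (psi' p).
have secE x : sec (cls x) = x - br x z.
  by rewrite /sec /cls phiK unit_section_pi.
constructor; apply: (@FockSplitting L cls sec poly inj) => //.
- by move=> a u v; rewrite /sec phi'_lin unit_section_linear.
- move=> a x y; rewrite /poly -psi_lin; congr psi; apply: val_inj.
  by rewrite val_sqP /= linear_brl.
- by move=> a p q; rewrite /inj psi'_lin val_sqP.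
- by move=> u; rewrite /cls /sec unit_sectionK // phiK'.
- move=> p; rewrite /poly -[RHS]psiK'; congr psi; apply: val_inj => /=.
  exact/ideal_br_z/valP.
- by move=> p; rewrite /cls pi_mem ?phi0 //; apply: valP.
- move=> u; rewrite /poly (_ : i_z _ = 0) ?psi0 //; apply: val_inj => /=.
  exact: br_unit_compl_z.
- by move=> v; rewrite secE /inj /poly psiK /= subrK.
- by move=> u v; rewrite /sec phi'_br unit_section_br.
- move=> p u; rewrite /inj -[p in RHS]psiK' -[u in RHS]phiK' -psi_act psiK.
  by rewrite -[phi' u](unit_sectionK z) // val_sq_act.
- by move=> v p; rewrite br_sq_ideal //; apply: valP.
Qed.

(** * The basis of the semidirect product *)

Section FockBasis.
Context (n_ge2 : (2 <= n)%N) {L : leibnizType F} (S : fock_splitting L).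
Local Notation xb := (fun i => split_sec S (nn1_xbar F n i)).
Local Notation d := (split_sec S (nn1_dbar F n)).
Local Notation xt := (fun t => split_inj S ('X^t : {poly F})).

(** The forms dual to the basis. Since $\overline{x^i} = i!\, x_{n-i}$ and
    [nn1_coord] numbers the coordinates from 0, the form dual to
    $\overline{x^i}$ reads the coordinate $n - i - 1$ and divides it by $i!$;
    inverting $i!$ uses characteristic zero. *)
Definition fock_coord (l : fock_label n) (v : L) : F :=
  match l with
  | xbar i => (i`!%:R)^-1 * nn1_coord (split_cls S v) (n - i).-1
  | dbar => nn1_coord (split_cls S v) 0
  | xpow t => (split_poly S v : {poly F})`_t
  end.

Lemma fact_neq0 k : k`!%:R != 0 :> F.
Proof. by move/pcharf0P: charF => ->; rewrite -lt0n fact_gt0. Qed.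

Lemma fock_coord_linear l a u v :
  fock_coord l (a *: u + v) = a * fock_coord l u + fock_coord l v.
Proof.
case: l => [i||t] /=; rewrite linearP ?nn1_coordD //.
  by rewrite mulrDr mulrCA.
by rewrite coefD coefZ.
Qed.

Lemma fock_coord_basis l m :
  fock_coord l (fock_basis xb d xt m) = (l == m)%:R.
Proof.
have coord0 k : nn1_coord (0 : 'rV[F]_n) k = 0.
  by rewrite /nn1_coord big1 // => i _; rewrite mxE.
case: l m => [i||t] [j||s] /=;
  rewrite ?split_secK ?split_cls_inj ?split_poly_sec ?split_injK ?coef0
          ?coord0 ?mulr0 //.
- rewrite nn1_coord_xbar; last by have := ltn_ord i; lia.
  case: (eqVneq (xbar i) (xbar j)) => [[->]|ij].
    rewrite (_ : (_ == _)%N) ?mulr1 ?mulVf ?fact_neq0 //.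
    by have := ltn_ord j; lia.
  rewrite (_ : (_ == _)%N = false) ?mulr0 //.
  apply/negbTE; apply: contra ij => /eqP eq_ij; apply/eqP; congr xbar.
  by apply: val_inj => /=; have := ltn_ord i; have := ltn_ord j; lia.
- rewrite nn1_coord_x; last by have := ltn_ord i; lia.
  rewrite (_ : (_ == 1)%N = false) ?mulr0 //.
  by have := ltn_ord i; lia.
- rewrite nn1_coord_xbar; last by lia.
  rewrite (_ : (_ == _)%N = false) ?mulr0 //.
  by have := ltn_ord j; lia.
- by rewrite nn1_coord_x //; lia.
- by rewrite coefXn; congr (_%:R).
Qed.

Lemma nn1_xbar_dbar_span (u : nn1 F n) :
  u = \sum_(i < n.-1) ((i`!%:R)^-1 * nn1_coord u (n - i).-1) *: nn1_xbar F n i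
      + nn1_coord u 0 *: nn1_dbar F n.
Proof.
apply/rowP => k; rewrite !mxE summxE; have hk := ltn_ord k.
have [k0|k_gt0] := posnP k.
  rewrite k0 eqxx mulr1 nn1_coordE k0 big1 ?add0r // => i _.
  rewrite mxE nn1_xbarE (_ : (_ == _)%N = false) ?mulr0 //.
  by have := ltn_ord i; lia.
(* The coordinate [k] is that of $x_{k+1}$, a multiple of
   $\overline{x^{n-k-1}}$. *)
have hi : (n - k.+1 < n.-1)%N by lia.
rewrite (bigD1 (Ordinal hi)) //= big1 => [|i ik].
  rewrite mxE nn1_xbarE (_ : (k.+1 == _)%N) ?mulr1; last by lia.
  rewrite (_ : (k.+1 == 1)%N = false) ?mulr0 ?addr0; last by lia.
  rewrite mulrAC mulVf ?fact_neq0 // mul1r nn1_coordE.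
  by congr nn1_coord; lia.
rewrite mxE nn1_xbarE (_ : (_ == _)%N = false) ?mulr0 //.
apply/negbTE; apply: contra ik => /eqP eq_ik; apply/eqP.
by apply: val_inj => /=; have := ltn_ord i; lia.
Qed.

Lemma fock_basis_is_basis : is_basis (fock_basis (n := n) xb d xt).
Proof.
apply: (@biorthogonal_basis _ _ _ _ fock_coord) => [l a u v|l m|v].
- exact: fock_coord_linear.
- exact: fock_coord_basis.
exists ([seq xbar i | i <- index_enum 'I_n.-1] ++
        dbar :: [seq xpow t | t <- iota 0 (size (split_poly S v : {poly F}))]).
rewrite big_cat big_cons !big_map /=.
rewrite {1}[v](split_decomp S) addrA; congr (_ + _).
  rewrite {1}[split_cls S v]nn1_xbar_dbar_span linearD linearZ linear_sum.
  by congr (_ + _); apply: eq_bigr => i _; rewrite linearZ.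
rewrite -[X in iota 0 X]subn0 -/(index_iota _ _) big_mkord /=.
have {1}-> : split_poly S v =
    \sum_(t < size (split_poly S v : {poly F}))
      (split_poly S v : {poly F})`_t *: ('X^t : fock charF n).
  by rewrite -[LHS]coefK poly_def.
by rewrite linear_sum; apply: eq_bigr => t _; rewrite linearZ.
Qed.

(** Brackets of lifts are lifts of brackets in $n_{n,1}$; brackets of a
    monomial with a lift are values of the Fock action; brackets with a
    monomial on the right vanish because $[L, I] = 0$. *)
Lemma br_fock_basis (a b : fock_label n) :
  br (fock_basis xb d xt a) (fock_basis xb d xt b) = fock_table xb d xt a b.
Proof.
have xb_d (i : 'I_n.-1) : br (xb i) d = i%:R *: xb i.-1.
  rewrite -split_sec_br nn1_br_xbar_dbar; first exact: linearZ.
  by have := ltn_ord i; lia.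
(* The table separates $i = 0$ from $i \geq 1$; the formulas for $i \geq 1$
   remain correct at $i = 0$, as the factor $i$ vanishes and $x^{t+0} = x^t$. *)
case: a b => [i||t] [j||s] /=; rewrite ?split_br_inj -?split_sec_br //.
- by rewrite nn1_br_xbar ?linear0 //; have := ltn_ord i; have := ltn_ord j; lia.
- by rewrite split_sec_br xb_d; case: posnP => // ->; rewrite scale0r.
- rewrite lie_br_antisym linearN /= split_sec_br xb_d.
  by case: posnP => // ->; rewrite scale0r oppr0.
- by rewrite brxx linear0.
- rewrite split_br_inj_sec fock_act_xbar; last by have := ltn_ord j; lia.
  by case: posnP => [->|_]; rewrite ?expr0 ?mul1r // -exprD addnC.
rewrite split_br_inj_sec fock_act_dbar; last by lia.
by rewrite derivXn -scaler_nat linearZ.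
Qed.

End FockBasis.
End FockSplitting.

Theorem theorem2 (F : closedFieldType) (charF : [pchar F] =i pred0)
    (n : nat) (n_ge3 : (3 <= n)%N) (L : leibnizType F)
    (L_Fock : filiform_Fock charF n L) :
  exists (xb : nat -> L) (d : L) (xt : nat -> L),
    is_basis (fock_basis (n := n) xb d xt) /\
    forall a b : fock_label n,
      br (fock_basis xb d xt a) (fock_basis xb d xt b) =
      fock_table xb d xt a b.
Proof.
have n_ge2 : (2 <= n)%N := ltnW n_ge3.
have [S] := filiform_Fock_split n_ge2 L_Fock.
exists (fun i => split_sec S (nn1_xbar F n i)), (split_sec S (nn1_dbar F n)).
exists (fun t => split_inj S ('X^t : {poly F})).
by split; [apply: fock_basis_is_basis | apply: br_fock_basis].
Qed.
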